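(* For all integers $0\le m\le n$, $$\sum_{k=m}^n s_{q,t}[n,k]\,S_{q,t}[k,m]=\delta_{m,n}\qquad\text{and}\qquad \sum_{k=m}^n S_{q,t}[n,k]\,s_{q,t}[k,m]=\delta_{m,n}.$$
   Context: Let $q,t$ be indeterminates. RG-words: $\mathcal R(n,k)$ is the set of words $w=w_1\cdots w_n$ of positive integers with $w_1=1$, $w_i\le\max(w_1,\dots,w_{i-1})+1$, and $\max_iw_i=k$; $\mathcal A(n,k)$ is the subset in which each even letter occurs exactly once. With $m_i=\max(w_1,\dots,w_i)$, $A(w)=\sum_{i\ge2}A_i(w)$ where $A_i(w)=w_i-1$ if $m_{i-1}\ge w_i$ and $0$ otherwise, and $B(w)=\#\{i\ge2: m_{i-1}>w_i\}$. For $n\ge1$, $1\le k\le n$ put $S_{q,t}[n,k]=\sum_{w\in\mathcal A(n,k)}q^{A(w)}t^{B(w)}$; also $S_{q,t}[n,0]=\delta_{n,0}$ and $S_{q,t}[n,k]=0$ for $k>n$. Rooks: the staircase board of length $n$ has squares $(i,j)$, $i,j\ge1$, $i+j\le n$ (row $i$ from top, column $j$ from left); square $(i,j)$ has $n-i-j$ squares below it in its column and is shaded if $n-i-j$ is even. $\mathcal{AR}(n,r)$ is the set of placements of $r$ rooks on shaded squares with no two in the same column; $\mathrm{below}(T)$ is the total number of squares below the rooks, $\mathrm{nrow}(T)$ the number of rooks not in row $1$. For $n\ge1$, $0\le k\le n$ put $s_{q,t}[n,k]=(-1)^{n-k}\sum_{T\in\mathcal{AR}(n,n-k)}q^{\mathrm{below}(T)}t^{\mathrm{nrow}(T)}$;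 also $s_{q,t}[0,0]=1$ and $s_{q,t}[n,k]=0$ for $k>n$. *)

(* Defs.v *)
From mathcomp Require Import all_boot all_order all_algebra.
From mathcomp Require Import mpoly.

Set Implicit Arguments.
Unset Strict Implicit.
Unset Printing Implicit Defensive.

Import GRing.Theory.
Local Open Scope ring_scope.

(* Words are 0-indexed: the letter w_(i+1) is [nth 0 w i], and
   [premax w i] is the maximum of the first i letters, i.e. m_i. *)
Definition premax (w : seq nat) (i : nat) : nat := (\max_(a <- take i w) a)%N.

Definition is_RG (k : nat) (w : seq nat) : bool :=
  [&& all (leq 1) w,
      nth 0%N w 0 == 1%N,
      [forall i : 'I_(size w),
         (0 < i)%N ==> (nth 0%N w i <= (premax w i).+1)%N]
    & premax w (size w) == k].

(* In an RG-word of maximum k every letter of {1, ..., k} occurs, so it is enough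
   to test the letters present in w. *)
Definition even_once (w : seq nat) : bool :=
  all (fun a => ~~ odd a ==> (count_mem a w == 1%N)) w.

Definition statA (w : seq nat) : nat :=
  (\sum_(1 <= i < size w)
     (if nth 0 w i <= premax w i then nth 0 w i - 1 else 0))%N.

Definition statB (w : seq nat) : nat :=
  count (fun i => nth 0 w i < premax w i)%N (index_iota 1 (size w)).

(* A word of maximum k has its letters in {0, ..., k}, hence the carrier
   [n.-tuple 'I_k.+1] contains all of them. *)
Definition word (n k : nat) (w : n.-tuple 'I_k.+1) : seq nat :=
  [seq nat_of_ord a | a <- w].

Definition RGwords (n k : nat) : {set n.-tuple 'I_k.+1} :=
  [set w : n.-tuple 'I_k.+1 | is_RG k (word w)].

Definition allowable (n k : nat) : {set n.-tuple 'I_k.+1} :=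
  [set w in RGwords n k | even_once (word w)].

Definition stirling2 (R : comNzRingType) (q t : R) (n k : nat) : R :=
  if k == 0%N then (n == 0%N)%:R
  else if (n < k)%N then 0
  else \sum_(w in allowable n k) q ^+ statA (word w) * t ^+ statB (word w).

(* The pair (i, j) is the square in row i and column j, both counted from 1. *)
Definition square (n : nat) : finType := ('I_n.+1 * 'I_n.+1)%type.

Definition staircase (n : nat) : {set square n} :=
  [set s : square n | [&& (0 < s.1)%N, (0 < s.2)%N & (s.1 + s.2 <= n)%N]].

Definition sq_below (n : nat) (s : square n) : nat := (n - s.1 - s.2)%N.

Definition shaded (n : nat) : {set square n} :=
  [set s in staircase n | ~~ odd (sq_below s)].

Definition rook_placements (n r : nat) : {set {set square n}} :=
  [set T : {set square n} |
     [&& T \subset shaded n, #|T| == r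
       & [forall x in T, forall y in T, (x.2 == y.2) ==> (x == y)]]].

Definition below (n : nat) (T : {set square n}) : nat :=
  (\sum_(s in T) sq_below s)%N.

Definition nrow (n : nat) (T : {set square n}) : nat :=
  #|[set s in T | s.1 != 1%N :> nat]|.

Definition stirling1 (R : comNzRingType) (q t : R) (n k : nat) : R :=
  if (n < k)%N then 0
  else if n == 0%N then 1
  else (-1) ^+ (n - k) *
       \sum_(T in rook_placements n (n - k)) q ^+ below T * t ^+ nrow T.

Definition qX : {mpoly int[2]} := 'X_ord0.
Definition tX : {mpoly int[2]} := 'X_ord_max.

(* Main.v *)
(* Let c_k be the sum of q^a t^[a+1 <> k] over the even a < k.  Deleting the
   last letter of a word gives S[n+1,k] = S[n,k-1] + c_k S[n,k], since an old
   letter that is repeated must be odd; deleting the first column of the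
   staircase gives s[n+1,k] = s[n,k-1] - c_n s[n,k], since c_n is also the
   generating function of the shaded squares of that column.  These two
   recurrences force the triangular arrays S and s to be mutually inverse. *)

Require Import Defs.
From mathcomp Require Import all_boot all_order all_algebra.
From mathcomp Require Import mpoly zify.

Import GRing.Theory.
Local Open Scope ring_scope.

Set Implicit Arguments.
Unset Strict Implicit.

(** * Inversion from recurrences *)

(** Stands for the term of index $k-1$, with the value 0 at $k=0$, so that the recurrences need no
    separate boundary case. *)
Definition shift (R : nmodType) (f : nat -> R) (m : nat) : R :=
  if m is m'.+1 then f m' else 0.

(** The coefficient may depend on both indices, which covers the factor $c_n$ of one array and $c_k$
    of the other. *)
Lemma triangular_eq0 (R : pzRingType) (a f : nat -> nat -> R) :
  (forall k, f 0%N k = (k == 0%N)%:R) ->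
  (forall n k, f n.+1 k = shift (f n) k + a n k * f n k) ->
  forall n k, (n < k)%N -> f n k = 0.
Proof.
move=> f0 fS; elim=> [|n IHn] [|k] // ltnk.
by rewrite fS /= !IHn ?mulr0 ?addr0 // ltnW.
Qed.

Lemma stirling_inversion (R : comPzRingType) (c : nat -> R)
    (s S : nat -> nat -> R) :
  (forall k, s 0%N k = (k == 0%N)%:R) ->
  (forall n k, s n.+1 k = shift (s n) k - c n * s n k) ->
  (forall k, S 0%N k = (k == 0%N)%:R) ->
  (forall n k, S n.+1 k = shift (S n) k + c k * S n k) ->
  forall m n, (m <= n)%N ->
    \sum_(m <= k < n.+1) s n k * S k m = (m == n)%:R /\
    \sum_(m <= k < n.+1) S n k * s k m = (m == n)%:R.
Proof.
move=> s0 sS S0 SS.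
have s_eq0: forall n k, (n < k)%N -> s n k = 0.
  apply: (triangular_eq0 (a := fun n _ => - c n)) => // n k.
  by rewrite sS mulNr.
have S_eq0: forall n k, (n < k)%N -> S n k = 0.
  exact: (triangular_eq0 (a := fun _ k => c k)).
(* Terms below [m] vanish by triangularity; starting at 0 gives a range independent of [m], as the
   inductions below require. *)
have widen (f g : nat -> nat -> R) n m : (forall k, (k < m)%N -> g k m = 0) ->
    (m <= n)%N ->
    \sum_(m <= k < n.+1) f n k * g k m = \sum_(k < n.+1) f n k * g k m.
  move=> g0 lemn; rewrite -[RHS](big_mkord xpredT (fun k => f n k * g k m)).
  rewrite (@big_cat_nat _ _ _ m 0) //=; last exact: leqW.
  rewrite [X in _ = X + _]big_nat_cond [X in _ = X + _]big1 ?add0r // => k.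
  by case/andP=> /andP[_ /g0->] _; rewrite mulr0.
have sumS (f g : nat -> nat -> R) n m :
    \sum_(k < n.+2) shift (f n) k * g k m = \sum_(k < n.+1) f n k * g k.+1 m.
  by rewrite big_ord_recl mul0r add0r.
have sumN (f : nat -> nat -> R) (g : nat -> R) n :
    (forall k, (n < k)%N -> f n k = 0) ->
    \sum_(k < n.+2) f n k * g k = \sum_(k < n.+1) f n k * g k.
  by move=> f0; rewrite big_ord_recr /= f0 // mul0r addr0.
have M1 n m : \sum_(k < n.+1) s n k * S k m = (m == n)%:R.
  elim: n m => [|n IHn] m.
    by rewrite big_ord_recl big_ord0 s0 S0 mul1r addr0.
  under eq_bigr => k _ do rewrite sS mulrBl.
  rewrite sumrB sumS.
  under [X in _ - X]eq_bigr => k _ do rewrite -mulrA mulrCA.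
  rewrite (sumN s (fun k => c n * S k m)); last exact: s_eq0.
  under [X in _ - X]eq_bigr => k _ do rewrite mulrCA.
  under [X in X - _]eq_bigr => k _ do rewrite SS mulrDr (mulrCA _ (c m)).
  rewrite big_split /= -!mulr_sumr IHn -addrA -mulrBl.
  (* The recurrence for [S] yields $c_m$ and the one for [s] yields $-c_n$; they cancel on the
     diagonal, and off it the inductive value is 0. *)
  have -> : (c m - c n) * (m == n)%:R = 0.
    by case: eqP => [->|_]; rewrite ?subrr ?mul0r ?mulr0.
  rewrite addr0; case: m => [|m] /=; last by rewrite IHn eqSS.
  by rewrite big1 // => k _; rewrite mulr0.
have M2 n m : \sum_(k < n.+1) S n k * s k m = (m == n)%:R.
  elim: n m => [|n IHn] m.
    by rewrite big_ord_recl big_ord0 s0 S0 mul1r addr0.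
  under eq_bigr => k _ do rewrite SS mulrDl -mulrA mulrCA.
  rewrite big_split /= sumS.
  rewrite (sumN S (fun k => c k * s k m)); last exact: S_eq0.
  rewrite -big_split /=.
  (* After regrouping, $S(n,k)$ multiplies $s(k+1,m)+c_k\,s(k,m)$, which the recurrence for [s]
     collapses to $s(k,m-1)$. *)
  under eq_bigr => k _ do rewrite sS -mulrDr subrK.
  case: m => [|m] /=; last by rewrite IHn eqSS.
  by rewrite big1 // => k _; rewrite mulr0.
by move=> m n lemn; split; rewrite widen // => k; [apply: S_eq0 | apply: s_eq0].
Qed.

(** * Allowable words *)

Definition maxw (w : seq nat) : nat := (\max_(a <- w) a)%N.

Lemma premax_size (w : seq nat) : premax w (size w) = maxw w.
Proof. by rewrite /premax take_size. Qed.

Lemma maxw_rcons (w : seq nat) (a : nat) : maxw (rcons w a) = maxn (maxw w) a.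
Proof. by rewrite /maxw -cats1 big_cat big_seq1. Qed.

Lemma leq_maxw (w : seq nat) (a : nat) : a \in w -> (a <= maxw w)%N.
Proof. by move=> wa; rewrite /maxw (big_rem a) //= leq_maxl. Qed.

Lemma premax_rcons (w : seq nat) (a i : nat) :
  (i <= size w)%N -> premax (rcons w a) i = premax w i.
Proof. by move=> lei; rewrite /premax -cats1 takel_cat. Qed.

Lemma statA_rcons (w : seq nat) (a : nat) :
  statA (rcons w a) = (statA w + (if a <= maxw w then a - 1 else 0))%N.
Proof.
rewrite /statA size_rcons; case: (posnP (size w)) => [/size0nil->|w_gt0].
  by rewrite !big_geq //= /maxw big_nil; case: a.
rewrite big_nat_recr //= nth_rcons ltnn eqxx premax_rcons // premax_size.
congr (_ + _)%N; apply: eq_big_nat => i /andP[_ lti].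
by rewrite nth_rcons lti premax_rcons // ltnW.
Qed.

Lemma statB_rcons (w : seq nat) (a : nat) :
  statB (rcons w a) = (statB w + (a < maxw w))%N.
Proof.
rewrite /statB size_rcons; case: (posnP (size w)) => [/size0nil->|w_gt0].
  by rewrite /= /maxw big_nil.
have -> : index_iota 1 (size w).+1 = index_iota 1 (size w) ++ [:: size w].
  by rewrite /index_iota subSn // -[(size w - 1).+1]addn1 iotaD subnKC.
rewrite count_cat /= addn0 nth_rcons ltnn eqxx premax_rcons // premax_size.
congr (_ + _)%N; apply: eq_in_count => i.
rewrite mem_index_iota => /andP[_ lti].
by rewrite nth_rcons lti premax_rcons // ltnW.
Qed.

(** The letters that may follow an allowable word. The new maximum is kept at the head so that a sum
    over this list splits into the two terms of the recurrence. *)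
Definition extensions (w : seq nat) : seq nat :=
  (maxw w).+1 :: [seq a <- iota 1 (maxw w) | odd a].

Lemma mem_extensions (w : seq nat) (a : nat) :
  (a \in extensions w) =
  (a == (maxw w).+1) || [&& (0 < a)%N, (a <= maxw w)%N & odd a].
Proof.
rewrite inE mem_filter mem_iota add1n ltnS.
by case: odd; rewrite ?andbT ?andbF.
Qed.

Lemma extensions_uniq (w : seq nat) : uniq (extensions w).
Proof.
rewrite /= filter_uniq ?iota_uniq // andbT mem_filter mem_iota.
by rewrite add1n ltnn !andbF.
Qed.

(** All maxima are generated together, since appending a letter can raise the maximum and thus
    change the carrier [n.-tuple 'I_k.+1]. *)
Fixpoint allowable_words (n : nat) : seq (seq nat) :=
  if n is n'.+1 then
    [seq rcons w a | w <- allowable_words n', a <- extensions w]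
  else [:: [::]].

Lemma allowable_words_uniq (n : nat) : uniq (allowable_words n).
Proof.
elim: n => [|n IHn] //.
apply: (@allpairs_uniq_dep _ (fun _ => nat : eqType) (seq nat : eqType)
  (fun w a => rcons w a) _ extensions) => //.
  by move=> w _; apply: extensions_uniq.
by move=> [w a] [w' a'] _ _ /= /rcons_inj[-> ->].
Qed.

Definition restricted_growth (w : seq nat) : bool :=
  all (fun i => nth 0 w i <= (premax w i).+1)%N (iota 0 (size w)).

Lemma restricted_growth_rcons (w : seq nat) (a : nat) :
  restricted_growth (rcons w a) =
  restricted_growth w && (a <= (maxw w).+1)%N.
Proof.
rewrite /restricted_growth size_rcons -[(size w).+1]addn1 iotaD all_cat /=.
rewrite andbT add0n nth_rcons ltnn eqxx premax_rcons // premax_size.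
congr (_ && _); apply: eq_in_all => i; rewrite mem_iota => /andP[_ lti].
by rewrite nth_rcons lti premax_rcons // ltnW.
Qed.

(** The running maximum starts at 0 and rises by at most one per letter, so no value is skipped. *)
Lemma mem_restricted_growth (w : seq nat) (b : nat) :
  all (leq 1) w -> restricted_growth w -> (0 < b <= maxw w)%N -> b \in w.
Proof.
elim/last_ind: w => [|w a IHw]; first by rewrite /maxw big_nil; case: b.
rewrite all_rcons restricted_growth_rcons => /andP[a_gt0 w1] /andP[wRG le_a].
rewrite maxw_rcons mem_rcons inE => /andP[b_gt0 le_b].
have [//|neq_ba /=] := eqVneq b a; apply: IHw => //; lia.
Qed.

(* Dropping the condition w_1 = 1, which follows from the others on nonempty
   words, makes the empty word a base case. *)
Definition allowable_word (w : seq nat) : bool :=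
  [&& all (leq 1) w, restricted_growth w & even_once w].

(** A new maximum occurs once and changes no other count. A letter up to the old maximum already
    occurs in [w], so appending it is a repetition, which only odd letters allow. *)
Lemma allowable_word_rcons (w : seq nat) (a : nat) :
  allowable_word (rcons w a) = allowable_word w && (a \in extensions w).
Proof.
rewrite /allowable_word all_rcons restricted_growth_rcons mem_extensions.
case: (boolP (all (leq 1) w)) => [w1|_]; last by rewrite !andbF.
case: (boolP (restricted_growth w)) => [wRG|_]; last by rewrite !andbF.
have memP b := @mem_restricted_growth w b w1 wRG.
rewrite /= andbT.
have evenS b : count_mem b (rcons w a) = ((a == b) + count_mem b w)%N.
  by rewrite -cats1 count_cat /= addn0 addnC.
have even_new : a = (maxw w).+1 -> even_once (rcons w a) = even_once w.
  move=> ea; have nwa : a \notin w by apply/negP=> /leq_maxw; rewrite ea ltnn.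
  rewrite /even_once all_rcons evenS eqxx (count_memPn nwa) implybT /=.
  apply: eq_in_all => b wb; rewrite evenS.
  by rewrite (_ : (a == b) = false) //; apply: contraNF nwa => /eqP->.
have even_old : (0 < a <= maxw w)%N ->
    even_once (rcons w a) = odd a && even_once w.
  move=> aw; have wa := memP a aw.
  rewrite /even_once all_rcons evenS eqxx; case: (boolP (odd a)) => /= oa.
    apply: eq_in_all => b wb; rewrite evenS; case: (eqVneq a b) => // <-.
    by rewrite oa.
  (* An even letter present in [w] would now be counted at least twice. *)
  by move: wa; rewrite -has_pred1 has_count; case: count.
case: (ltngtP a (maxw w).+1) => [lt_a|gt_a|eq_a].
- case: (posnP a) => [->|a_gt0]; first by rewrite !andbF.
  by rewrite -ltnS lt_a /= even_old ?a_gt0 // andbC.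
- by rewrite !andbF /=; case: (leqP a (maxw w)) => [|_]; [lia | rewrite !andbF].
- by rewrite even_new // eq_a /= andbT.
Qed.

Lemma mem_allowable_words (n : nat) (w : seq nat) :
  (w \in allowable_words n) = (size w == n) && allowable_word w.
Proof.
elim: n w => [|n IHn] w; first by rewrite inE; case: w.
have memS : reflect (exists v a,
    [/\ v \in allowable_words n, a \in extensions v & w = rcons v a])
    (w \in allowable_words n.+1).
  exact: (@allpairsPdep _ (fun _ => nat : eqType)).
elim/last_ind: w memS => [|w a _] memS.
  by rewrite /= (introF memS) // => -[w [a [_ _]]]; case: w.
rewrite size_rcons eqSS allowable_word_rcons andbA -IHn.
apply/memS/andP => [[v [b [vP bP /rcons_inj[-> ->]]]]|[wP aP]] //.
by exists w, a.
Qed.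

Lemma is_RGE (k : nat) (w : seq nat) :
  w != [::] ->
  is_RG k w && even_once w = allowable_word w && (maxw w == k).
Proof.
case: w => // a w _; rewrite /is_RG /allowable_word premax_size.
have [/andP[a_gt0 _]|_] := boolP (all (leq 1) (a :: w)); last by [].
have <- : (nth 0%N (a :: w) 0 == 1%N) && [forall i : 'I_(size (a :: w)),
    (0 < i)%N ==> (nth 0 (a :: w) i <= (premax (a :: w) i).+1)%N]
  = restricted_growth (a :: w).
  rewrite /restricted_growth [iota _ _]/= [in RHS]/all -/(all _ _).
  rewrite [nth _ _ _]/=.
  (* At index 0 the previous maximum is 0, so growth reads $w_1\le1$, which positivity turns into
     $w_1=1$. *)
  rewrite [premax _ 0]/premax take0 big_nil eqn_leq a_gt0 andbT; congr (_ && _).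
  apply/forallP/allP => [h i|h i].
    rewrite mem_iota => /andP[i_gt0 lti].
    by have /implyP := h (Ordinal lti); apply.
  by apply/implyP=> i_gt0; apply: h; rewrite mem_iota i_gt0 add1n ltn_ord.
move: (_ == 1%N) [forall _, _] (even_once _) (_ == k) => [] [] [] [] //.
Qed.

Lemma sum_allowable (R : pzSemiRingType) (n k : nat) (F : seq nat -> R) :
  (0 < n)%N ->
  \sum_(w in allowable n k) F (word w) =
  \sum_(w <- allowable_words n | maxw w == k) F w.
Proof.
move=> n_gt0; rewrite -[RHS]big_filter -[LHS]big_enum.
rewrite -(big_map (@word n k) xpredT F).
apply: perm_big; apply: uniq_perm.
- rewrite map_inj_uniq ?enum_uniq // => u v /(inj_map (@ord_inj _)).
  exact: val_inj.
- by rewrite filter_uniq ?allowable_words_uniq.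
move=> w; rewrite mem_filter mem_allowable_words.
apply/mapP/idP => [[u]|/and3P[/eqP mw /eqP sw aw]].
  rewrite mem_enum !inE => uP ->.
  have su : size (word u) = n by rewrite size_map size_tuple.
  rewrite su eqxx /= andbC -is_RGE // -size_eq0 su; lia.
(* [inord] loses nothing here, since every letter is at most [maxw w], which is [k]. *)
have sz : size [seq inord a : 'I_k.+1 | a <- w] == n by rewrite size_map sw.
have wE : word (Tuple sz) = w.
  rewrite /word /= -map_comp -[RHS]map_id; apply/eq_in_map => a wa /=.
  by rewrite inordK // ltnS -mw leq_maxw.
exists (Tuple sz) => //; rewrite mem_enum !inE wE is_RGE ?aw ?mw ?eqxx //.
by rewrite -size_eq0 sw; lia.
Qed.

(* With letters a+1, this is the total weight of the odd letters that can be
   repeated after an RG-word of maximum n. *)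
Definition column_sum (R : pzSemiRingType) (q t : R) (n : nat) : R :=
  \sum_(0 <= a < n | ~~ odd a) q ^+ a * t ^+ (a.+1 != n).

Definition word_sum (R : pzSemiRingType) (q t : R) (n k : nat) : R :=
  \sum_(w <- allowable_words n | maxw w == k) q ^+ statA w * t ^+ statB w.

Lemma word_sum0 (R : pzSemiRingType) (q t : R) (k : nat) :
  word_sum q t 0 k = (k == 0%N)%:R.
Proof.
rewrite /word_sum big_mkcond big_seq1 /maxw big_nil eq_sym.
by case: eqP => // _; rewrite /statA /statB big_geq //= !expr0 mulr1.
Qed.

(** Sum over the last letter. A new maximum adds nothing to either statistic; a repeated letter
    $a+1$ adds $a$ to [statA], and 1 to [statB] unless it equals the maximum. *)
Lemma word_sumS (R : comPzSemiRingType) (q t : R) (n k : nat) :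
  word_sum q t n.+1 k =
  shift (word_sum q t n) k + column_sum q t k * word_sum q t n k.
Proof.
rewrite /word_sum big_mkcond.
rewrite (@big_allpairs_dep _ _ _ _ (fun _ => nat) _ (fun w a => rcons w a)).
under eq_bigr => w _ do rewrite big_cons big_filter.
rewrite big_split /=; congr (_ + _).
  case: k => [|k] /=.
    by rewrite big1 // => w _; rewrite maxw_rcons (maxn_idPr (leqnSn _)).
  rewrite [RHS]big_mkcond; apply: eq_bigr => w _.
  rewrite maxw_rcons (maxn_idPr (leqnSn _)) eqSS statA_rcons statB_rcons.
  by rewrite ltnn ltnNge leqnSn !addn0.
rewrite [in RHS]big_mkcond mulr_sumr; apply: eq_bigr => w _.
(* Repeating a letter keeps the maximum, so only words of maximum [k] contribute. *)
rewrite big_seq_cond; case: (eqVneq (maxw w) k) => [mw|neq_mw]; last first.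
  rewrite mulr0 big1 // => a; rewrite mem_iota add1n ltnS.
  move=> /andP[/andP[_ le_a] _].
  by rewrite maxw_rcons (maxn_idPl le_a) (negPf neq_mw).
rewrite -big_seq_cond /column_sum mw.
have -> : iota 1 k = index_iota 1 k.+1 by rewrite /index_iota subSS subn0.
rewrite big_add1 /= mulr_suml [LHS]big_nat_cond [RHS]big_nat_cond.
apply: eq_big => [a|a /andP[/andP[_ lt_ak] _]] //.
rewrite maxw_rcons mw (maxn_idPl lt_ak) eqxx statA_rcons statB_rcons mw lt_ak.
by rewrite subn1 /= !exprD mulrACA mulrC (ltn_neqAle a.+1) lt_ak andbT.
Qed.

Lemma stirling2E (R : comNzRingType) (q t : R) (n k : nat) :
  stirling2 q t n k = word_sum q t n k.
Proof.
have eq0 : forall n k, (n < k)%N -> word_sum q t n k = 0.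
  apply: (@triangular_eq0 _ (fun _ k => column_sum q t k)).
    exact: word_sum0.
  exact: word_sumS.
rewrite /stirling2; case: k => [|k] /=; case: n => [|n] /=.
- by rewrite word_sum0.
(* No letter can be repeated at maximum 0, so the recurrence itself gives the conventional value
   0. *)
- by rewrite word_sumS /column_sum big_geq // mul0r addr0.
- by rewrite word_sum0.
case: ltnP => [/eq0-> //|_].
exact: (sum_allowable _ (fun w => q ^+ statA w * t ^+ statB w)).
Qed.

(** * Rook placements *)

(** Generalizes [rook_placements] to an arbitrary board and column map, so that columns can be
    deleted without changing the type of squares. *)
Definition placements (X : finType) (Y : eqType) (c : X -> Y) (D : {set X})
    (r : nat) : {set {set X}} :=
  [set T : {set X} | [&& T \subset D, #|T| == r
     & [forall x in T, forall y in T, (c x == c y) ==> (x == y)]]].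

Lemma placementsP (X : finType) (Y : eqType) (c : X -> Y) (D : {set X})
    (r : nat) (T : {set X}) :
  reflect [/\ T \subset D, #|T| = r & {in T &, injective c}]
          (T \in placements c D r).
Proof.
rewrite inE; apply: (iffP and3P) => -[TD /eqP cardT injT]; split=> //.
  move=> x y Tx Ty cxy; move/forall_inP/(_ x Tx)/forall_inP/(_ y Ty): injT.
  by rewrite cxy eqxx => /eqP.
apply/forall_inP=> x Tx; apply/forall_inP=> y Ty.
by apply/implyP=> /eqP/injT->.
Qed.

Definition rook_sum (R : comPzRingType) (X : finType) (Y : eqType) (c : X -> Y)
    (W : X -> R) (D : {set X}) (r : nat) : R :=
  \sum_(T in placements c D r) \prod_(x in T) W x.

Lemma rook_sum0 (R : comPzRingType) (X : finType) (Y : eqType) (c : X -> Y)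
    (W : X -> R) (D : {set X}) :
  rook_sum c W D 0 = 1.
Proof.
rewrite /rook_sum (big_pred1 set0) ?big_set0 // => T; rewrite /=.
apply/placementsP/eqP => [[_ /cards0_eq-> //]|->].
by split; rewrite ?sub0set ?cards0 // => x; rewrite inE.
Qed.

Lemma rook_sum_set0 (R : comPzRingType) (X : finType) (Y : eqType) (c : X -> Y)
    (W : X -> R) (r : nat) :
  rook_sum c W set0 r.+1 = 0.
Proof.
rewrite /rook_sum big1 // => T /placementsP[].
by rewrite subset0 => /eqP->; rewrite cards0.
Qed.

(** Split by whether column [j] is empty. A rook there puts no constraint on the other columns, so
    its weight factors out. *)
Lemma rook_sum_delete_column (R : comPzRingType) (X : finType) (Y : eqType)
    (c : X -> Y) (W : X -> R) (D : {set X}) (j : Y) (r : nat) :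
  let D0 := [set x in D | c x != j] in
  rook_sum c W D r.+1 =
    rook_sum c W D0 r.+1
    + (\sum_(x in D | c x == j) W x) * rook_sum c W D0 r.
Proof.
move=> D0; rewrite /rook_sum (bigID (fun T : {set X} => T \subset D0)) /=.
have D0D: D0 \subset D by apply/subsetP=> x; rewrite inE => /andP[].
congr (_ + _).
  apply: eq_bigl => T; apply/andP/placementsP.
    by case=> /placementsP[].
  case=> TD0 cT iT; split=> //; apply/placementsP; split=> //.
  exact: subset_trans TD0 D0D.
rewrite mulr_suml.
(* A placement not contained in D0 has exactly one rook x in column j, and
   removing x gives a placement on D0. *)
have uniq_rook T : (T \in placements c D r.+1) && ~~ (T \subset D0) ->
    \prod_(x in T) W x =
    \sum_(x in D | (c x == j) && (x \in T)) \prod_(y in T) W y.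
  case/andP=> /placementsP[TD _ injT] /subsetPn[x Tx].
  have Dx := subsetP TD x Tx; rewrite inE Dx negbK => /eqP cx.
  rewrite [RHS](big_pred1 x) // => y /=; apply/and3P/eqP => [[_ /eqP cy Ty]|->].
    by apply: injT; rewrite // cx cy.
  by rewrite cx eqxx Dx Tx.
rewrite (eq_bigr _ uniq_rook).
(* Exchanging the sums groups the placements by their rook in column [j]. *)
rewrite (exchange_big_dep (fun x => (x \in D) && (c x == j))) /=; last first.
  by move=> T x _ /and3P[-> ->].
apply: eq_bigr => x /andP[Dx /eqP cx].
rewrite (reindex_onto (fun T => x |: T) (fun T => T :\ x)) /=; last first.
  by move=> T /andP[_ /and3P[_ _ Tx]]; rewrite setD1K.
rewrite mulr_sumr.
have xP T : T \in placements c D0 r -> x \notin T.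
  case/placementsP=> TD0 _ _; apply/negP=> /(subsetP TD0).
  by rewrite inE cx eqxx andbF.
transitivity (\sum_(T in placements c D0 r) \prod_(y in x |: T) W y);
  last first.
  by apply: eq_bigr => T TP; rewrite big_setU1 //= xP.
apply: eq_bigl => T.
apply/idP/idP.
  rewrite Dx cx eqxx setU11 /= andbT.
  move=> /andP[/andP[/placementsP[TD cT iT] _] /eqP xT].
  have nTx : x \notin T by rewrite -xT !inE eqxx.
  apply/placementsP; split.
  - apply/subsetP=> y Ty; have xy : y \in x |: T by rewrite inE Ty orbT.
    rewrite inE (subsetP TD) //=; apply/eqP=> cy.
    by move: nTx; rewrite (iT x y) ?Ty ?setU11 // cx cy.
  - by move: cT; rewrite cardsU1 nTx add1n => -[].
  - by move=> y z Ty Tz; apply: iT; rewrite inE ?Ty ?Tz orbT.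
move=> TP; have nTx := xP T TP; case/placementsP: TP => TD0 cT iT.
rewrite Dx cx eqxx setU11 /= andbT; apply/andP; split; last by rewrite setU1K.
have cy y : y \in T -> c y != j.
  by move/(subsetP TD0); rewrite inE => /andP[].
apply/andP; split.
  apply/placementsP; split.
  - by rewrite subUset sub1set Dx (subset_trans TD0).
  - by rewrite cardsU1 nTx cT.
  - move=> y z; rewrite !inE => /orP[/eqP->|Ty] /orP[/eqP->|Tz] // e.
    + by move: (cy z Tz); rewrite -e cx eqxx.
    + by move: (cy y Ty); rewrite e cx eqxx.
    + exact: iT.
by apply/subsetPn; exists x; rewrite ?setU11 // inE cx eqxx andbF.
Qed.

(** * Signed rook sums as elementary symmetric functions of the column sums *)

Fixpoint elementary_sym (R : pzSemiRingType) (c : nat -> R) (n r : nat) : R :=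
  match n, r with
  | _, 0%N => 1
  | 0%N, _.+1 => 0
  | n'.+1, r'.+1 => elementary_sym c n' r + c n' * elementary_sym c n' r'
  end.

Lemma elementary_sym0 (R : pzSemiRingType) (c : nat -> R) (n : nat) :
  elementary_sym c n 0 = 1.
Proof. by case: n. Qed.

Lemma elementary_sym_eq0 (R : pzSemiRingType) (c : nat -> R) (n r : nat) :
  (n < r)%N -> elementary_sym c n r = 0.
Proof.
elim: n r => [|n IHn] [|r] //= ltnr.
by rewrite !IHn ?mulr0 ?addr0 // ltnW.
Qed.

Definition rook_weight (R : pzSemiRingType) (q t : R) (n : nat)
    (s : square n) : R :=
  q ^+ sq_below s * t ^+ (s.1 != 1%N :> nat).

Lemma prod_rook_weight (R : comPzSemiRingType) (q t : R) (n : nat)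
    (T : {set square n}) :
  \prod_(s in T) rook_weight q t s = q ^+ below T * t ^+ nrow T.
Proof.
rewrite big_split /= /below expr_sum; congr (_ * _).
rewrite /nrow -sum1dep_card big_mkcondr expr_sum.
by apply: eq_bigr => s _; case: ifP.
Qed.

(** The square in row $i$ has $a=n-j-i$ squares below it: shading says that $a$ is even, and row 1
    is the case $a+1=n-j$. Hence the sum is reversed. *)
Lemma sum_column (R : pzSemiRingType) (q t : R) (n : nat) (j : 'I_n.+1) :
  (0 < j)%N ->
  \sum_(s in shaded n | s.2 == j) rook_weight q t s = column_sum q t (n - j).
Proof.
move=> j_gt0; rewrite (reindex_onto (fun i => (i, j)) fst) /=; last first.
  by move=> [i k] /andP[_ /eqP /= ->].
rewrite /column_sum big_nat_rev add0n.
rewrite -(big_add1 _ _ 0 (n - j).+1 (fun i => ~~ odd (n - j - i))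
   (fun i => q ^+ (n - j - i) * t ^+ ((n - j - i).+1 != n - j)%N)).
(* The range is widened to all row indices; the bounds on the row move into the condition. *)
rewrite (@big_nat_widenl _ _ _ 1 0) //.
rewrite (@big_nat_widen _ _ _ 0 _ n.+1); last lia.
rewrite big_mkord /=; apply: eq_big => [i|i].
  rewrite !inE /sq_below /= !eqxx !andbT; lia.
rewrite !inE /rook_weight /sq_below /= => H.
by rewrite subnAC; congr (_ * _ ^+ nat_of_bool _); lia.
Qed.

(** The last [m] columns have $m-1,\dots,0$ squares and each holds at most one rook. The induction
    adds columns from right to left, matching the recursion of [elementary_sym]. *)
Lemma rook_sum_columns (R : comPzRingType) (q t : R) (n m r : nat) :
  (m <= n)%N ->
  rook_sum snd (@rook_weight R q t n) [set s in shaded n | n - m < s.2]%N r =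
  elementary_sym (column_sum q t) m r.
Proof.
elim: m r => [|m IHm] [|r] le_mn; rewrite ?rook_sum0 ?elementary_sym0 //.
  rewrite subn0 (_ : [set s in _ | _] = set0) ?rook_sum_set0 //.
  by apply/setP=> s; rewrite !inE [(n < _)%N]ltnNge -(ltnS s.2) ltn_ord andbF.
(* The column added is $n-m$, which has $m$ squares and so contributes [column_sum q t m]. *)
have lt_j : (n - m < n.+1)%N by lia.
rewrite (rook_sum_delete_column _ _ _ (Ordinal lt_j)) /=.
set D0 := finset _; have -> : D0 = [set s in shaded n | n - m < s.2]%N.
  apply/setP=> s; rewrite /D0 !inE -val_eqE /= -!andbA.
  by do 4!congr (_ && _); lia.
rewrite !IHm 1?ltnW //; congr (_ + _ * _).
rewrite (_ : column_sum q t m = column_sum q t (n - Ordinal lt_j)); last first.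
  by congr column_sum => /=; lia.
rewrite -sum_column /=; last by lia.
apply: eq_bigl => s; rewrite !inE -val_eqE /=; lia.
Qed.

Lemma stirling1E (R : comNzRingType) (q t : R) (n k : nat) :
  stirling1 q t n k =
  if (n < k)%N then 0
  else (-1) ^+ (n - k) * elementary_sym (column_sum q t) n (n - k).
Proof.
rewrite /stirling1; case: ltnP => // le_kn; case: eqP => [n0|_].
  by rewrite n0 in le_kn *; rewrite sub0n mul1r.
congr (_ * _); rewrite -(rook_sum_columns _ _ _ (leqnn n)) subnn.
have -> : [set s in shaded n | 0 < s.2]%N = shaded n.
  by apply/setP=> s; rewrite !inE; lia.
by apply: eq_bigr => T _; rewrite prod_rook_weight.
Qed.

Lemma stirling1_0 (R : comNzRingType) (q t : R) (k : nat) :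
  stirling1 q t 0 k = (k == 0%N)%:R.
Proof. by case: k. Qed.

(** This is the recursion of [elementary_sym]; its product term has degree one lower, whence the
    minus sign. *)
Lemma stirling1S (R : comNzRingType) (q t : R) (n k : nat) :
  stirling1 q t n.+1 k =
  shift (stirling1 q t n) k - column_sum q t n * stirling1 q t n k.
Proof.
case: k => [|k] /=; rewrite !stirling1E.
  (* At $k=0$ the degree $n+1$ exceeds the number $n$ of variables, so only the product term
     survives. *)
  rewrite !subn0 /= elementary_sym_eq0 // !add0r exprS mulN1r mulNr.
  by rewrite mulrCA.
rewrite ltnS subSS; case: (ltngtP n k) => [lt_nk|lt_kn|->].
- by rewrite ltnW ?mulr0 ?subr0 // ltnW.
- rewrite ltnNge lt_kn /= -(subnSK lt_kn) /= mulrDr exprS.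
  by rewrite mulN1r [X in _ + X]mulNr mulrCA.
- by rewrite subnn ltnSn !mulr0 subr0 !elementary_sym0.
Qed.

(** * Inversion of the two $q,t$-Stirling arrays *)

Unset Implicit Arguments.

Theorem theorem9p4 (m n : nat) (le_mn : (m <= n)%N) :
  \sum_(m <= k < n.+1) stirling1 qX tX n k * stirling2 qX tX k m
    = (m == n)%:R
  /\
  \sum_(m <= k < n.+1) stirling2 qX tX n k * stirling1 qX tX k m
    = (m == n)%:R.
Proof.
apply: (@stirling_inversion _ (column_sum qX tX)) => // {m n le_mn}.
- exact: stirling1_0.
- exact: stirling1S.
- by move=> k; rewrite stirling2E word_sum0.
- move=> n k; rewrite !stirling2E word_sumS; congr (_ + _).
  by case: k => //= k; rewrite stirling2E.
Qed.
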